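(* Let $A$ be an algebra in a variety $\mathcal{V}(I)$ and let $\pi: G \to \operatorname{End}_0(A)$ be an ideal partial representation of $G$ on $A$. Suppose that for any $f(x_1,\ldots,x_n)\in I$ there exists $i$ such that $x_i$ appears in each monomial of $f$. Endow $\Lambda(A)$ with the product determined by $\lfloor g,a\rfloor\lfloor h,b\rfloor=\lfloor g,a\,\pi_{g^{-1}h}(b)\rfloor$ ($g,h\in G$, $a,b\in A$). Let $\Theta: G\curvearrowright\Lambda(A)$ be given by $\Theta_g(\lfloor h,a\rfloor)=\lfloor gh,a\rfloor$ and let $\iota:A\to\Lambda(A)$, $\iota(a)=\lfloor 1,a\rfloor$. Then $\Lambda(A)\in\mathcal{V}(I)$ and $(\Theta,\iota)$ is a globalization of the partial action $\alpha$ on the algebra $A$ induced by $\pi$. Moreover, the product determined by $\lfloor g,a\rfloor\lfloor h,b\rfloor=\lfloor g,a\,\pi_{g^{-1}h}(b)\rfloor$ ($g,h\in G$, $a,b\in A$) is the unique one on the $K$-module $\Lambda(A)$ such that the map $\tau:\Lambda(A)\to A$, $\tau(\lfloor g,a\rfloor)=\pi_g(a)$, is an algebra homomorphism, $\iota(A)$ is an ideal of $\Lambda(A)$, and $(\Theta,\iota)$ is a globalization of $\alpha$.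
   Context: $K$ is an associative commutative unital ring, all modules, algebras and tensor products are over $K$, and $G$ is a group. A non-associative algebra is a $K$-module with a $K$-bilinear product, not necessarily associative or unital. $F(X)$ is the free non-associative (non-unital) $K$-algebra on a countable set $X$ of variables; for $I\subseteq F(X)$, the variety $\mathcal{V}(I)$ is the class of all non-associative algebras $A$ with $f(a_1,\ldots,a_n)=0$ for all $f\in I$ and all $a_i\in A$. $\operatorname{End}_0(A)$ is the monoid of algebra endomorphisms of $A$ (not required to preserve a unit). An ideal partial representation of $G$ on $A$ is a map $\pi:G\to\operatorname{End}_0(A)$ with $\pi_1=\mathrm{id}$, $\pi_{g^{-1}}\pi_g\pi_h=\pi_{g^{-1}}\pi_{gh}$ and $\pi_g\pi_h\pi_{h^{-1}}=\pi_{gh}\pi_{h^{-1}}$ for all $g,h\in G$, such that each $\operatorname{im}\pi_g$ is a two-sided ideal of $A$. A partial action $\alpha:G\curvearrowright A$ on an algebra $A$ consists of two-sided ideals $A_g\subseteq A$ and algebra isomorphisms $\alpha_g:A_{g^{-1}}\to A_g$ ($g\in G$) such that $A_1=A$, $\alpha_1=\mathrm{id}$; $\alpha_g(A_{g^{-1}}\cap A_{g^{-1}h})\subseteq A_g\cap A_h$; and $\alpha_g\alpha_h(x)=\alpha_{gh}(x)$ for $x\in A_{h^{-1}}\cap A_{h^{-1}g^{-1}}$. It is global if all $A_g=A$. The partial action induced by $\pi$ has $A_g=\operatorname{im}\pi_g$ and $\alpha_g=\pi_g|_{A_{g^{-1}}}$. A $G$-equivariant map between (partial) actions $\alpha$ on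 $A$ and $\beta$ on $B$ of $G$ on algebras is an algebra homomorphism $\phi:A\to B$ with $\phi(A_g)\subseteq B_g$ and $\phi(\alpha_g(x))=\beta_g(\phi(x))$ for $x\in A_{g^{-1}}$; it is an isomorphism if it is bijective with $G$-equivariant inverse. The restriction of a global action $\beta:G\curvearrowright B$ to an ideal $C$ of $B$ is given by $C_g=C\cap\beta_g(C)$ and the restrictions of $\beta_g$ to $C_{g^{-1}}$. A globalization of a partial action $\alpha:G\curvearrowright A$, $A\in\mathcal{V}(I)$, is a pair $(\Theta,\iota)$, where $\Theta:G\curvearrowright B$ is a global action (by algebra automorphisms) on an algebra $B\in\mathcal{V}(I)$ and $\iota:A\to B$ is an injective $G$-equivariant map, such that $\iota(A)$ is a two-sided ideal of $B$, $\alpha$ is isomorphic to the restriction of $\Theta$ to $\iota(A)$, and $B=\sum_{g\in G}\Theta_g(\iota(A))$. $\Lambda(A)$ is the quotient of the $K$-module $KG\otimes A$ by the submodule generated by all $g\otimes\alpha_h(a)-gh\otimes a$ with $g,h\in G$, $a\in A_{h^{-1}}$; $\lfloor g,a\rfloor$ denotes the class of $g\otimes a$. The displayed product and the maps $\Theta_g$, $\iota$, $\tau$ are well defined. *)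

(* Defs.v *)
From HB Require Import structures.
From mathcomp Require Import all_boot all_algebra.
From mathcomp Require Import finmap.
From mathcomp Require Import boolp classical_sets functions.

Set Implicit Arguments.
Unset Strict Implicit.
Unset Printing Implicit Defensive.

Import GRing.Theory.

Local Open Scope classical_set_scope.
Local Open Scope ring_scope.

(* The base ring is a [comPzRingType]: the zero ring is allowed. *)

Section FreeModule.
Context {K : comPzRingType} {T : choiceType}.

(* Finitely supported functions T -> K. *)
Record freemod := FreeMod { freemod_val : {fsfun T -> K with 0} }.

HB.instance Definition _ := [isNew for freemod_val].
HB.instance Definition _ := [Choice of freemod by <:].

Implicit Types (x y z : freemod) (t : T) (k : K).

Definition coef x t : K := freemod_val x t.
Definition supp x : {fset T} := finsupp (freemod_val x).

Lemma freemodP x y : coef x =1 coef y -> x = y.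
Proof. by move=> e; apply: val_inj; apply/fsfunP. Qed.

Definition freemod_zero : freemod := FreeMod [fsfun].
Definition freemod_opp x : freemod :=
  FreeMod [fsfun t in supp x => - coef x t].
Definition freemod_add x y : freemod :=
  FreeMod [fsfun t in (supp x `|` supp y)%fset => coef x t + coef y t].
Definition freemod_scale k x : freemod :=
  FreeMod [fsfun t in supp x => k * coef x t].

Lemma coef_out x t : t \notin supp x -> coef x t = 0.
Proof. exact: fsfun_dflt. Qed.

Lemma coef_zero t : coef freemod_zero t = 0.
Proof. by rewrite /coef /= fsfunE. Qed.

Lemma coef_opp x t : coef (freemod_opp x) t = - coef x t.
Proof.
by rewrite {1}/coef /= fsfunE; case: ifPn => // /coef_out ->; rewrite oppr0.
Qed.

Lemma coef_add x y t : coef (freemod_add x y) t = coef x t + coef y t.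
Proof.
rewrite {1}/coef /= fsfunE inE; case: ifPn => //.
by rewrite negb_or => /andP[/coef_out -> /coef_out ->]; rewrite addr0.
Qed.

Lemma coef_scale k x t : coef (freemod_scale k x) t = k * coef x t.
Proof.
by rewrite {1}/coef /= fsfunE; case: ifPn => // /coef_out ->; rewrite mulr0.
Qed.

Let coefE := (coef_zero, coef_opp, coef_add, coef_scale).

Fact freemod_addA : associative freemod_add.
Proof. by move=> x y z; apply: freemodP => t; rewrite !coefE addrA. Qed.
Fact freemod_addC : commutative freemod_add.
Proof. by move=> x y; apply: freemodP => t; rewrite !coefE addrC. Qed.
Fact freemod_add0 : left_id freemod_zero freemod_add.
Proof. by move=> x; apply: freemodP => t; rewrite !coefE add0r. Qed.
Fact freemod_addN : left_inverse freemod_zero freemod_opp freemod_add.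
Proof. by move=> x; apply: freemodP => t; rewrite !coefE addNr. Qed.

HB.instance Definition _ := GRing.isZmodule.Build freemod
  freemod_addA freemod_addC freemod_add0 freemod_addN.

Fact freemod_scaleA k l x :
  freemod_scale k (freemod_scale l x) = freemod_scale (k * l) x.
Proof. by apply: freemodP => t; rewrite !coefE mulrA. Qed.
Fact freemod_scale1 : left_id 1 freemod_scale.
Proof. by move=> x; apply: freemodP => t; rewrite !coefE mul1r. Qed.
Fact freemod_scaleDr : right_distributive freemod_scale +%R.
Proof. by move=> k x y; apply: freemodP => t; rewrite !coefE mulrDr. Qed.
Fact freemod_scaleDl x : {morph freemod_scale^~ x : k l / k + l}.
Proof. by move=> k l; apply: freemodP => t; rewrite !coefE mulrDl. Qed.

HB.instance Definition _ := GRing.Zmodule_isLmodule.Build K freemod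
  freemod_scaleA freemod_scale1 freemod_scaleDr freemod_scaleDl.

Lemma coef_linear t k x y : coef (k *: x + y) t = k * coef x t + coef y t.
Proof. by rewrite coef_add coef_scale. Qed.

Definition basis t : freemod := FreeMod [fsfun u in [fset t]%fset => 1].

Lemma coef_basis t u : coef (basis t) u = (u == t)%:R.
Proof. by rewrite /coef /= fsfunE inE; case: (u == t). Qed.

Definition free_lift (V : lmodType K) (f : T -> V) (x : freemod) : V :=
  \sum_(t <- supp x) coef x t *: f t.

Lemma free_liftw (V : lmodType K) (f : T -> V) (D : {fset T}) x :
  (supp x `<=` D)%fset -> free_lift f x = \sum_(t <- D) coef x t *: f t.
Proof.
move=> sub; rewrite /free_lift; apply: big_fset_incl => // t _ /coef_out ->.
by rewrite scale0r.
Qed.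

Lemma free_lift_linear (V : lmodType K) (f : T -> V) : linear (free_lift f).
Proof.
move=> k x y.
pose D := (supp (k *: x + y)%R `|` (supp x `|` supp y))%fset.
rewrite !(@free_liftw _ _ D) ?fsubsetUl //.
- rewrite scaler_sumr -big_split; apply: eq_bigr => t _ /=.
  by rewrite coef_linear scalerDl scalerA.
- by rewrite /D fsetUA fsubsetUr.
- by rewrite /D fsetUCA fsubsetUl.
Qed.

Lemma free_lift_basis (V : lmodType K) (f : T -> V) t :
  free_lift f (basis t) = f t.
Proof.
rewrite (@free_liftw _ _ [fset t]%fset); last first.
  apply/fsubsetP => u; rewrite inE; apply: contraLR => nut.
  by rewrite memNfinsupp -/(coef _ _) coef_basis (negPf nut).
by rewrite big_seq_fset1 coef_basis eqxx scale1r.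
Qed.

Lemma free_liftE x : x = free_lift basis x.
Proof.
apply: freemodP => u.
have cs (s : seq T) :
    coef (\sum_(t <- s) coef x t *: basis t) u
    = \sum_(t <- s) coef x t * coef (basis t) u.
  elim: s => [|t s IHs]; first by rewrite !big_nil coef_zero.
  by rewrite !big_cons coef_linear IHs.
rewrite cs; have [us|us] := boolP (u \in supp x).
  rewrite (big_fsetD1 u) //= coef_basis eqxx mulr1 big1_fset ?addr0 // => t.
  by rewrite !inE coef_basis eq_sym => /andP[/negPf -> _]; rewrite mulr0.
rewrite (coef_out us) big1_fset // => t ts _; rewrite coef_basis.
by case: eqP ts us => [->|]; rewrite ?mulr0 // => ->.
Qed.

Lemma free_ext (V : lmodType K) (f g : freemod -> V) :
  linear f -> linear g -> (forall t, f (basis t) = g (basis t)) -> f =1 g.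
Proof.
move=> lf lg e x; rewrite [x]free_liftE /free_lift.
have f0 (h : freemod -> V) : linear h -> h 0 = 0.
  by move=> lh; have := lh (-1) 0 0; rewrite scaler0 addr0 scaleN1r addNr.
elim: (enum_fset (supp x)) => [|t s IHs]; first by rewrite big_nil !f0.
by rewrite big_cons lf lg e IHs.
Qed.

End FreeModule.

Arguments freemod : clear implicits.
#[global] Opaque basis.

Section QuotientModule.
Context {K : comPzRingType} {V : lmodType K}.

Definition is_submod (N : set V) : Prop :=
  N 0 /\ forall k x y, N x -> N y -> N (k *: x + y).

Definition submod_gen (S : set V) : set V :=
  [set x | forall N, is_submod N -> S `<=` N -> N x].

Lemma submod_gen_submod S : is_submod (submod_gen S).
Proof.
split=> [N [] //|k x y Sx Sy N hN SN].
by case: (hN) => _; apply; [exact: Sx|exact: Sy].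
Qed.

Lemma sub_submod_gen S : S `<=` submod_gen S.
Proof. by move=> x Sx N _; apply. Qed.

Variable S : set V.

Definition quot_rel : rel V := fun x y => `[< submod_gen S (x - y) >].

Fact quot_rel_refl : reflexive quot_rel.
Proof. by move=> x; apply/asboolP; rewrite subrr; case: (submod_gen_submod S). Qed.

Fact quot_rel_sym : symmetric quot_rel.
Proof.
suff h x y : quot_rel x y -> quot_rel y x.
  by move=> x y; apply/idP/idP; exact: h.
move=> /asboolP Sxy; apply/asboolP; have [S0 SD] := submod_gen_submod S.
by rewrite -opprB -scaleN1r -[_ *: _]addr0; exact: SD.
Qed.

Fact quot_rel_trans : transitive quot_rel.
Proof.
move=> y x z /asboolP Sxy /asboolP Syz; apply/asboolP.
have [_ SD] := submod_gen_submod S.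
have -> : x - z = 1 *: (x - y) + (y - z) by rewrite scale1r addrA subrK.
exact: SD.
Qed.

Canonical quot_equiv := EquivRel quot_rel quot_rel_refl quot_rel_sym quot_rel_trans.

Local Open Scope quotient_scope.

(* V / <S>, the quotient of V by the submodule generated by S. *)
Definition quotmod : Type := {eq_quot quot_equiv}.

HB.instance Definition _ := Choice.on quotmod.
HB.instance Definition _ := EqQuotient.on quotmod.

(* Here and below, locking only prevents unification from unfolding nested
   quotients. *)
Fact quot_pi_key : unit. Proof. exact: tt. Qed.
Definition quot_pi : V -> quotmod :=
  locked_with quot_pi_key (fun x => \pi_quotmod x).

Lemma quot_piP x y : quot_pi x = quot_pi y <-> submod_gen S (x - y).
Proof.
rewrite /quot_pi unlock.
by split=> [/eqmodP/asboolP//|h]; apply/eqmodP/asboolP.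
Qed.

Lemma quot_ind (P : quotmod -> Prop) : (forall x, P (quot_pi x)) -> forall q, P q.
Proof. by move=> h q; have := h (repr q); rewrite /quot_pi unlock reprK. Qed.

Lemma repr_pi x : submod_gen S (repr (quot_pi x) - x).
Proof. by apply/quot_piP; rewrite /quot_pi unlock reprK. Qed.

Definition quot_zero : quotmod := quot_pi 0.
Definition quot_opp (p : quotmod) : quotmod := quot_pi (- repr p).
Definition quot_add (p q : quotmod) : quotmod := quot_pi (repr p + repr q).
Definition quot_scale k (p : quotmod) : quotmod := quot_pi (k *: repr p).

Let SD := (submod_gen_submod S).2.
Let S0 := (submod_gen_submod S).1.

Lemma quot_oppE x : quot_opp (quot_pi x) = quot_pi (- x).
Proof.
apply/quot_piP; rewrite -opprD -[- (_ - _)]scaleN1r -[_ *: _]addr0.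
by apply: SD => //; exact: repr_pi.
Qed.

Lemma quot_addE x y : quot_add (quot_pi x) (quot_pi y) = quot_pi (x + y).
Proof.
apply/quot_piP; rewrite opprD addrACA -[X in X + _]scale1r.
by apply: SD; exact: repr_pi.
Qed.

Lemma quot_scaleE k x : quot_scale k (quot_pi x) = quot_pi (k *: x).
Proof.
apply/quot_piP; rewrite -scalerBr -[_ *: _]addr0.
by apply: SD => //; exact: repr_pi.
Qed.

Let quotE := (quot_oppE, quot_addE, quot_scaleE).

Fact quot_addA : associative quot_add.
Proof.
by elim/quot_ind => x; elim/quot_ind => y; elim/quot_ind => z; rewrite !quotE addrA.
Qed.
Fact quot_addC : commutative quot_add.
Proof. by elim/quot_ind => x; elim/quot_ind => y; rewrite !quotE addrC. Qed.
Fact quot_add0 : left_id quot_zero quot_add.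
Proof. by elim/quot_ind => x; rewrite !quotE add0r. Qed.
Fact quot_addN : left_inverse quot_zero quot_opp quot_add.
Proof. by elim/quot_ind => x; rewrite !quotE addNr. Qed.

HB.instance Definition _ := GRing.isZmodule.Build quotmod
  quot_addA quot_addC quot_add0 quot_addN.

Fact quot_piD x y : quot_pi (x + y) = quot_pi x + quot_pi y.
Proof. by rewrite -quot_addE. Qed.

Fact quot_scaleA k l p : quot_scale k (quot_scale l p) = quot_scale (k * l) p.
Proof. by elim/quot_ind: p => x; rewrite !quotE scalerA. Qed.
Fact quot_scale1 : left_id 1 quot_scale.
Proof. by elim/quot_ind => x; rewrite !quotE scale1r. Qed.
Fact quot_scaleDr : right_distributive quot_scale +%R.
Proof.
move=> k; elim/quot_ind => x; elim/quot_ind => y.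
by rewrite -quot_piD !quotE scalerDr quot_piD.
Qed.
Fact quot_scaleDl p : {morph quot_scale^~ p : k l / k + l}.
Proof. by move=> k l; elim/quot_ind: p => x; rewrite !quotE scalerDl quot_piD. Qed.

HB.instance Definition _ := GRing.Zmodule_isLmodule.Build K quotmod
  quot_scaleA quot_scale1 quot_scaleDr quot_scaleDl.

Lemma quot_pi_linear : linear quot_pi.
Proof. by move=> k x y; rewrite -quot_addE -quot_scaleE. Qed.

Definition quot_lift (W : lmodType K) (f : V -> W) (p : quotmod) : W := f (repr p).

Section Lift.
Variables (W : lmodType K) (f : V -> W).
Hypothesis (lf : linear f) (fS : forall x, S x -> f x = 0).

Lemma quot_liftE x : quot_lift f (quot_pi x) = f x.
Proof.
have kerf : is_submod [set x | f x = 0].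
  have f0 : f 0 = 0 by have := lf (-1) 0 0; rewrite scaler0 addr0 scaleN1r addNr.
  by split=> //= k u v fu fv; rewrite lf fu fv scaler0 addr0.
have := repr_pi x => /(_ _ kerf fS) /= e; rewrite /quot_lift.
by rewrite -[repr _](subrK x) -[_ - x]scale1r lf e scaler0 add0r.
Qed.

Lemma quot_lift_linear : linear (quot_lift f).
Proof.
move=> k; elim/quot_ind => x; elim/quot_ind => y.
by rewrite -quot_pi_linear !quot_liftE lf.
Qed.

End Lift.

End QuotientModule.

Arguments quotmod {K V} S.

Section Tensor.
Context {K : comPzRingType} {M N : lmodType K}.

Local Notation e p := (basis p : freemod K (M * N)%type).

Inductive tensor_rel : set (freemod K (M * N)%type) :=
| TensorRelL k m m' n :
    tensor_rel (e (k *: m + m', n) - (k *: e (m, n) + e (m', n)))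
| TensorRelR k m n n' :
    tensor_rel (e (m, k *: n + n') - (k *: e (m, n) + e (m, n'))).

Definition tensor : lmodType K := quotmod tensor_rel.

Fact tens_key : unit. Proof. exact: tt. Qed.
Definition tens : M -> N -> tensor :=
  locked_with tens_key (fun m n => quot_pi _ (e (m, n))).

Lemma tensE m n : tens m n = quot_pi _ (e (m, n)).
Proof. by rewrite /tens unlock. Qed.

Lemma tensDl n : linear (tens^~ n).
Proof.
move=> k m m'; rewrite !tensE -quot_pi_linear; apply/quot_piP.
by apply: sub_submod_gen; exact: TensorRelL.
Qed.

Lemma tensDr m : linear (tens m).
Proof.
move=> k n n'; rewrite !tensE -quot_pi_linear; apply/quot_piP.
by apply: sub_submod_gen; exact: TensorRelR.
Qed.

Definition tensor_lift (W : lmodType K) (b : M -> N -> W) : tensor -> W :=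
  quot_lift (free_lift (fun p => b p.1 p.2)).

Lemma linearB0 (U W : lmodType K) (f : U -> W) x y :
  linear f -> f x = f y -> f (x - y) = 0.
Proof.
by move=> lf exy; rewrite -scaleN1r addrC lf exy scaleN1r addNr.
Qed.

Section TensorLift.
Variables (W : lmodType K) (b : M -> N -> W).
Hypothesis (bl : forall n, linear (b^~ n)) (br : forall m, linear (b m)).

Let lb := free_lift_linear (fun p : (M * N)%type => b p.1 p.2).

Fact tensor_lift_rel x :
  tensor_rel x -> free_lift (fun p => b p.1 p.2) x = 0.
Proof.
by case=> [k m m' n|k m n n']; apply: linearB0 lb _;
  rewrite lb !free_lift_basis ?bl ?br.
Qed.

Lemma tensor_lift_linear : linear (tensor_lift b).
Proof. exact: quot_lift_linear lb tensor_lift_rel. Qed.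

Lemma tensor_liftE m n : tensor_lift b (tens m n) = b m n.
Proof.
by rewrite /tensor_lift tensE (quot_liftE lb tensor_lift_rel) free_lift_basis.
Qed.

End TensorLift.

Lemma tensor_ext (W : lmodType K) (f g : tensor -> W) :
  linear f -> linear g -> (forall m n, f (tens m n) = g (tens m n)) -> f =1 g.
Proof.
move=> lf lg efg; apply: (@quot_ind _ _ tensor_rel) => x.
apply: (@free_ext _ _ _ (f \o quot_pi _) (g \o quot_pi _)) => [k y z|k y z|[m n]] /=.
- by rewrite quot_pi_linear lf.
- by rewrite quot_pi_linear lg.
- by rewrite -tensE; exact: efg.
Qed.

End Tensor.

Arguments tensor {K} M N.

Definition bilinear_op (K : comPzRingType) (V : lmodType K) (mul : V -> V -> V) :
    Prop :=
  (forall y, linear (mul^~ y)) /\ (forall x, linear (mul x)).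

Record naAlg (K : comPzRingType) := NaAlg {
  na_mod :> lmodType K;
  na_mul : na_mod -> na_mod -> na_mod;
  na_mul_bilinear : bilinear_op na_mul
}.

Notation "x ** y" := (na_mul x y) (at level 40, left associativity) : ring_scope.

Section NonassociativeAlgebras.
Context {K : comPzRingType}.
Implicit Types A B : naAlg K.

Definition alg_hom A B (f : A -> B) : Prop :=
  linear f /\ {morph f : x y / x ** y}.

Record End0 A := { End0_fun :> A -> A; End0_hom : alg_hom End0_fun }.

Definition is_ideal A (C : set A) : Prop :=
  is_submod C /\ forall x y, C x -> C (x ** y) /\ C (y ** x).

End NonassociativeAlgebras.

Section IdealAlgebra.
Context {K : comPzRingType} {B : naAlg K} {C : set B}.

Definition ideal_sort (hC : is_ideal C) : Type := {x : B | x \in C}.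

Variable hC : is_ideal C.

HB.instance Definition _ := SubChoice.on (ideal_sort hC).

Fact ideal_submod_closed : submod_closed (mem C).
Proof.
have [C0 CD] := hC.1; split=> [|k x y]; first by rewrite inE.
by rewrite !inE; exact: CD.
Qed.

HB.instance Definition _ :=
  GRing.SubChoice_isSubLmodule.Build K B (mem C) (ideal_sort hC)
    ideal_submod_closed.

Fact ideal_mul_subproof (x y : ideal_sort hC) : val x ** val y \in C.
Proof. by have := valP x; rewrite !inE => Cx; case: (hC.2 _ (val y) Cx). Qed.

Definition ideal_mul (x y : ideal_sort hC) : ideal_sort hC :=
  Sub (val x ** val y) (ideal_mul_subproof x y).


Fact ideal_mul_bilinear : bilinear_op ideal_mul.
Proof.
have [Dl Dr] := na_mul_bilinear B.
by split=> [y|x] k u v; apply: val_inj; [exact: Dl|exact: Dr].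
Qed.

Definition ideal_alg : naAlg K := NaAlg ideal_mul_bilinear.

End IdealAlgebra.

Section FreeAlgebra.

(* Nonempty bracketed words in the variables x_0, x_1, ... *)
Inductive monomial := Var of nat | Mul of monomial & monomial.

HB.instance Definition _ := gen_eqMixin monomial.
HB.instance Definition _ := gen_choiceMixin monomial.

Fixpoint occurs (i : nat) (m : monomial) : bool :=
  match m with
  | Var j => i == j
  | Mul s t => occurs i s || occurs i t
  end.

Context {K : comPzRingType}.

Definition free_mul (f g : freemod K monomial) : freemod K monomial :=
  free_lift (fun s => free_lift (fun t => basis (Mul s t)) g) f.

Fact free_mul_bilinear : bilinear_op free_mul.
Proof.
split=> [g|f]; first exact: free_lift_linear.
move=> k g h; rewrite /free_mul /free_lift scaler_sumr -big_split /=.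
apply: eq_bigr => s _; rewrite -/(free_lift _ _) free_lift_linear.
by rewrite scalerDr !scalerA mulrC.
Qed.

Definition free_alg : naAlg K := NaAlg free_mul_bilinear.

Fixpoint eval_monomial (A : naAlg K) (a : nat -> A) (m : monomial) : A :=
  match m with
  | Var j => a j
  | Mul s t => eval_monomial a s ** eval_monomial a t
  end.

Definition eval (A : naAlg K) (a : nat -> A) : free_alg -> A :=
  free_lift (eval_monomial a).

Lemma eval_var (A : naAlg K) (a : nat -> A) i : eval a (basis (Var i)) = a i.
Proof. exact: free_lift_basis. Qed.

Lemma eval_hom (A : naAlg K) (a : nat -> A) : alg_hom (eval a).
Proof.
have le : linear (eval a) := free_lift_linear (eval_monomial a).
have [Fl Fr] := free_mul_bilinear; have [Al Ar] := na_mul_bilinear A.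
split=> // f g; apply: (@free_ext _ _ _ (fun f => eval a (free_mul f g))
                          (fun f => eval a f ** eval a g)) f.
- by move=> k x y; rewrite Fl le.
- by move=> k x y; rewrite le Al.
move=> s; apply: (@free_ext _ _ _ (fun g => eval a (free_mul (basis s) g))
                    (fun g => eval a (basis s) ** eval a g)) g.
- by move=> k x y; rewrite Fr le.
- by move=> k x y; rewrite le Ar.
by move=> t; rewrite /free_mul !free_lift_basis /eval !free_lift_basis.
Qed.

Definition in_variety (I : set free_alg) (A : naAlg K) : Prop :=
  forall f, I f -> forall a : nat -> A, eval a f = 0.

End FreeAlgebra.

Arguments free_alg K : clear implicits.

Section PartialActions.
Context {K : comPzRingType} {G : groupType}.
Implicit Types A B : naAlg K.

Local Open Scope group_scope.

(* Each isomorphism A_{g^-1} -> A_g is represented by a total function, whose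
   values outside A_{g^-1} are irrelevant. *)
Record paction A := PAction { dom : G -> set A; act : G -> A -> A }.

Definition alg_iso_on A (D E : set A) (f : A -> A) : Prop :=
  [/\ set_bij D E f,
      forall k x y, D x -> D y -> f (k *: x + y) = k *: f x + f y
    & forall x y, D x -> D y -> f (x ** y) = f x ** f y].

Definition is_paction A (alpha : paction A) : Prop :=
  [/\ (forall g, is_ideal (dom alpha g))
      /\ (forall g, alg_iso_on (dom alpha g^-1) (dom alpha g) (act alpha g)),
      dom alpha 1 = setT /\ (forall x, act alpha 1 x = x),
      forall g h,
        act alpha g @` (dom alpha g^-1 `&` dom alpha (g^-1 * h))
          `<=` dom alpha g `&` dom alpha h
    & forall g h x, dom alpha h^-1 x -> dom alpha (h^-1 * g^-1) x ->
        act alpha g (act alpha h x) = act alpha (g * h) x].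

Definition is_global A (alpha : paction A) : Prop :=
  forall g, dom alpha g = setT.

Definition total_paction A (Theta : G -> A -> A) : paction A :=
  {| dom := fun=> setT; act := Theta |}.

Definition equivariant A B (alpha : paction A) (beta : paction B) (phi : A -> B) :
    Prop :=
  [/\ alg_hom phi,
      forall g, phi @` dom alpha g `<=` dom beta g
    & forall g x, dom alpha g^-1 x -> phi (act alpha g x) = act beta g (phi x)].

Definition isomorphic A B (alpha : paction A) (beta : paction B) : Prop :=
  exists (phi : A -> B) (psi : B -> A),
    [/\ cancel phi psi, cancel psi phi,
        equivariant alpha beta phi & equivariant beta alpha psi].

(* [insubd] is the corestriction of [act beta g] to C: for x in C_{g^-1} the
   value lies in C, so the default is not used. *)
Definition restriction B (C : set B) (beta : paction B) (hC : is_ideal C) :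
    paction (ideal_alg hC) :=
  {| dom := fun g => [set x : ideal_alg hC |
              (C `&` act beta g @` C) (val (x : ideal_sort hC))];
     act := fun g x => insubd (x : ideal_sort hC)
              (act beta g (val (x : ideal_sort hC))) |}.

Definition is_globalization (I : set (free_alg K)) A (alpha : paction A)
    B (Theta : paction B) (iota : A -> B) : Prop :=
  [/\ is_paction alpha /\ in_variety I A,
      [/\ in_variety I B, is_paction Theta & is_global Theta],
      injective iota /\ equivariant alpha Theta iota,
      exists hC : is_ideal (range iota), isomorphic alpha (restriction Theta hC)
    & forall b : B, exists s : seq (G * A)%type,
        b = \sum_(p <- s) act Theta p.1 (iota p.2)].

Record ideal_prep A := IdealPRep {
  prep_fun :> G -> End0 A;
  prep1 : forall a, prep_fun 1 a = a;
  prepVM : forall g h a,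
    prep_fun g^-1 (prep_fun g (prep_fun h a)) = prep_fun g^-1 (prep_fun (g * h) a);
  prepMV : forall g h a,
    prep_fun g (prep_fun h (prep_fun h^-1 a)) = prep_fun (g * h) (prep_fun h^-1 a);
  prep_ideal : forall g, is_ideal (range (prep_fun g))
}.

Definition induced A (pi : ideal_prep A) : paction A :=
  {| dom := fun g => range (pi g); act := fun g => pi g |}.

Section Lambda.
Context {A : naAlg K}.

Definition Lambda_rel (alpha : paction A) : set (tensor (freemod K G) A) :=
  [set z | exists g h a, dom alpha h^-1 a /\
     z = tens (basis g) (act alpha h a) - tens (basis (g * h)) a].

Definition Lambda (alpha : paction A) : lmodType K := quotmod (Lambda_rel alpha).

Variable alpha : paction A.

Definition Lclass (g : G) (a : A) : Lambda alpha := quot_pi _ (tens (basis g) a).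

Lemma Lclass_linear g : linear (Lclass g).
Proof. by move=> k a b; rewrite /Lclass tensDr quot_pi_linear. Qed.

Lemma Lclass_act g h a :
  dom alpha h^-1 a -> Lclass g (act alpha h a) = Lclass (g * h) a.
Proof.
by move=> ha; apply/quot_piP; apply: sub_submod_gen; exists g, h, a.
Qed.

Fact Lambda_lift_key : unit. Proof. exact: tt. Qed.
Definition Lambda_lift (W : lmodType K) (phi : G -> A -> W) : Lambda alpha -> W :=
  locked_with Lambda_lift_key
    (quot_lift (tensor_lift (fun x a => free_lift (phi^~ a) x))).

Section LambdaLift.
Variables (W : lmodType K) (phi : G -> A -> W).
Hypothesis phi_lin : forall g, linear (phi g).
Hypothesis phi_act : forall g h a,
  dom alpha h^-1 a -> phi g (act alpha h a) = phi (g * h) a.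

Let b (x : freemod K G) (a : A) : W := free_lift (phi^~ a) x.

Fact Lambda_lift_bl a : linear (b^~ a).
Proof. exact: free_lift_linear. Qed.

Fact Lambda_lift_br x : linear (b x).
Proof.
move=> k a a'; rewrite /b /free_lift scaler_sumr -big_split; apply: eq_bigr => g _.
by rewrite phi_lin scalerDr !scalerA /= mulrC.
Qed.

Let lb := tensor_lift_linear Lambda_lift_bl Lambda_lift_br.

Fact Lambda_lift_tens g a : tensor_lift b (tens (basis g) a) = phi g a.
Proof.
rewrite (tensor_liftE Lambda_lift_bl Lambda_lift_br); exact: free_lift_basis.
Qed.

Fact Lambda_lift_rel z : Lambda_rel alpha z -> tensor_lift b z = 0.
Proof.
case=> g [h [a [ha ->]]].
apply: (linearB0 (f := tensor_lift b) lb).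
by rewrite !Lambda_lift_tens phi_act.
Qed.

Lemma Lambda_lift_linear : linear (Lambda_lift phi).
Proof. rewrite /Lambda_lift unlock; exact: quot_lift_linear lb Lambda_lift_rel. Qed.

Lemma Lambda_liftE g a : Lambda_lift phi (Lclass g a) = phi g a.
Proof.
rewrite /Lambda_lift unlock /Lclass (quot_liftE lb Lambda_lift_rel).
exact: Lambda_lift_tens.
Qed.

End LambdaLift.

Lemma Lambda_ext (W : lmodType K) (f f' : Lambda alpha -> W) :
  linear f -> linear f' -> (forall g a, f (Lclass g a) = f' (Lclass g a)) ->
  f =1 f'.
Proof.
move=> lf lf' e; apply: (@quot_ind _ _ (Lambda_rel alpha)) => z.
apply: (@tensor_ext _ _ _ _ (f \o quot_pi _) (f' \o quot_pi _)) => [k y y'|k y y'|x a] /=.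
- by rewrite quot_pi_linear lf.
- by rewrite quot_pi_linear lf'.
apply: (@free_ext _ _ _ (fun x => f (quot_pi _ (tens x a)))
                   (fun x => f' (quot_pi _ (tens x a)))) => [k y y'|k y y'|g].
- by rewrite tensDl quot_pi_linear lf.
- by rewrite tensDl quot_pi_linear lf'.
exact: e.
Qed.

(* The linear extension of the formula in [Lambda_thetaE]. *)
Definition Lambda_theta (g : G) : Lambda alpha -> Lambda alpha :=
  Lambda_lift (fun h a => Lclass (g * h) a).

Lemma Lambda_theta_linear g : linear (Lambda_theta g).
Proof.
apply: Lambda_lift_linear => [h|h k a ha]; first exact: Lclass_linear.
by rewrite Lclass_act // mulgA.
Qed.

Lemma Lambda_thetaE g h a : Lambda_theta g (Lclass h a) = Lclass (g * h) a.
Proof.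
apply: Lambda_liftE => [k|k l b hb]; first exact: Lclass_linear.
by rewrite Lclass_act // mulgA.
Qed.

Definition Lambda_iota (a : A) : Lambda alpha := Lclass 1 a.

End Lambda.

Fact linear_swap (V : lmodType K) k l (u v w z : V) :
  k *: (l *: u + v) + (l *: w + z) = l *: (k *: u + w) + (k *: v + z).
Proof. by rewrite !scalerDr !scalerA [(k * l)%R]mulrC addrACA. Qed.

Section LambdaProduct.
Context {A : naAlg K}.
Variable pi : ideal_prep A.

Local Notation L := (Lambda (induced pi)).
Local Notation cl := (Lclass (induced pi)).

Let pi_lin g : linear (pi g) := (End0_hom (pi g)).1.
Let piM g : {morph pi g : x y / x ** y} := (End0_hom (pi g)).2.

Let mulDl := (na_mul_bilinear A).1.
Let mulDr := (na_mul_bilinear A).2.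

Lemma prepK g x : range (pi g) x -> pi g (pi g^-1 x) = x.
Proof.
by case=> y _ <-; have := prepVM pi g^-1 g y; rewrite invgK mulVg prep1.
Qed.

Lemma prep_comp g h x : range (pi h^-1) x -> pi g (pi h x) = pi (g * h) x.
Proof. by case=> y _ <-; exact: prepMV. Qed.

Lemma induced_paction : is_paction (induced pi).
Proof.
have imK g x : range (pi g^-1) x -> pi g^-1 (pi g x) = x.
  by move=> /prepK; rewrite invgK.
split=> /=.
- split=> g; first exact: prep_ideal.
  split=> [|k x y _ _|x y _ _]; [|exact: pi_lin|exact: piM].
  split=> [x _|x y|x gx]; first by exists x.
    by rewrite !inE => gx gy e; rewrite -(imK _ _ gx) e imK.
  by exists (pi g^-1 x); [exists x|exact: prepK].
- split=> [|x]; last exact: prep1.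
  by apply/seteqP; split=> // x _; exists x => //; exact: prep1.
- move=> g h _ [x [gx hx] <-]; split; first by exists x.
  by rewrite -(prepK hx) prepMV mulVKg; eexists.
- by move=> g h x hx _; exact: prep_comp.
Qed.

Let mulr (g : G) (a : A) : L -> L :=
  Lambda_lift (fun h b => cl g (a ** pi (g^-1 * h) b)).

Fact mulr_lin g a h : linear (fun b => cl g (a ** pi (g^-1 * h) b)).
Proof. by move=> k b c; rewrite pi_lin mulDr Lclass_linear. Qed.

Fact mulr_act g a h k b : dom (induced pi) k^-1 b ->
  cl g (a ** pi (g^-1 * h) (act (induced pi) k b))
  = cl g (a ** pi (g^-1 * (h * k)) b).
Proof. by move=> kb; rewrite /= prep_comp // mulgA. Qed.

Let mulr_linear g a : linear (mulr g a).
Proof.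
by apply: Lambda_lift_linear => *; [exact: mulr_lin|exact: mulr_act].
Qed.

Let mulrE g a h b : mulr g a (cl h b) = cl g (a ** pi (g^-1 * h) b).
Proof.
by apply: Lambda_liftE => *; [exact: mulr_lin|exact: mulr_act].
Qed.

(* The bilinear extension of the formula in [Lambda_mulE]. *)
Definition Lambda_mul (x y : L) : L :=
  Lambda_lift (fun g a => mulr g a y) x.

Fact mull_lin y g : linear (fun a => mulr g a y).
Proof.
move=> k a b; move: y.
apply: (Lambda_ext (alpha := induced pi)) => [||h c].
- exact: mulr_linear.
- by move=> l x y; rewrite !mulr_linear; exact: linear_swap.
- by rewrite !mulrE mulDl Lclass_linear.
Qed.

Fact mull_act y g h a : dom (induced pi) h^-1 a ->
  mulr g (act (induced pi) h a) y = mulr (g * h) a y.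
Proof.
move=> ha; move: y; apply: (Lambda_ext (alpha := induced pi)) => [||k c].
- exact: mulr_linear.
- exact: mulr_linear.
rewrite !mulrE /=; set b := pi (g^-1 * k) c.
have -> : cl (g * h) (a ** pi ((g * h)^-1 * k) c)
          = cl g (pi h (a ** pi ((g * h)^-1 * k) c)).
  by rewrite (@Lclass_act _ (induced pi)) //; apply: ((prep_ideal pi _).2 _ _ ha).1.
have hha : range (pi h) (pi h a) by exists a.
have := prepVM pi h^-1 (g^-1 * k) c; rewrite !invgK -/b => e.
rewrite piM invgM -mulgA -e; congr cl.
have /prepK <- := ((prep_ideal pi h).2 _ b hha).1.
by rewrite !piM prepK.
Qed.

Lemma Lambda_mul_bilinear : bilinear_op Lambda_mul.
Proof.
have lin_l y : linear (Lambda_mul^~ y).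
  by apply: Lambda_lift_linear => *; [exact: mull_lin|exact: mull_act].
have cl_l g a y : Lambda_mul (cl g a) y = mulr g a y.
  by apply: Lambda_liftE => *; [exact: mull_lin|exact: mull_act].
split; first exact: lin_l.
move=> x k y z; apply: (Lambda_ext (alpha := induced pi)
  (f := Lambda_mul^~ (k *: y + z))
  (f' := fun x => k *: Lambda_mul x y + Lambda_mul x z)) => [||g a].
- exact: lin_l.
- by move=> l u v; rewrite !lin_l; exact: linear_swap.
- by rewrite !cl_l mulr_linear.
Qed.

Lemma Lambda_mulE g a h b :
  Lambda_mul (cl g a) (cl h b) = cl g (a ** pi (g^-1 * h) b).
Proof.
rewrite -mulrE; apply: (Lambda_liftE (alpha := induced pi)) => *.
- exact: mull_lin.
- exact: mull_act.
Qed.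

Definition Lambda_alg : naAlg K := NaAlg Lambda_mul_bilinear.

(* The linear extension of the formula in [Lambda_tauE]. *)
Definition Lambda_tau : L -> A := Lambda_lift (fun g => pi g).

Lemma Lambda_tau_linear : linear Lambda_tau.
Proof. by apply: Lambda_lift_linear => // g h a; exact: prep_comp. Qed.

Lemma Lambda_tauE g a : Lambda_tau (cl g a) = pi g a.
Proof. by apply: Lambda_liftE => // {}g h {}a; exact: prep_comp. Qed.

End LambdaProduct.
End PartialActions.

Arguments Lambda_iota {K G A} alpha a.
Arguments paction {K} G A.
Arguments ideal_prep {K} G A.
Arguments Lambda_theta {K G A} alpha g _.
Arguments Lambda_mul {K G A} pi x y.
Arguments Lambda_tau {K G A} pi _.

(* Main.v *)
Require Import Defs.
From mathcomp Require Import all_boot all_algebra.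
From mathcomp Require Import finmap.
From mathcomp Require Import boolp classical_sets.

(** Write [g, a] for the class of g (x) a. The map tau : [g, a] |-> pi_g(a) is
    multiplicative because pi_g pi_{g^-1} is the identity on the ideal im pi_g.
    Composing it with the translations Theta_{g^-1} gives algebra homomorphisms
    from Lambda(A) to A, one for each g, which send [h, b] to pi_{g^-1 h}(b).

    The key point is that these components are jointly injective
    ([Lambda_component_sep]). The class [g, x_g] built on the component x_g of
    x at g acts as the part of x at g: it equals [g, a] when x = [g, a], and
    when x = [h, b] it can be rewritten as another class at h. So if all
    components of x = [g_1, a_1] + ... + [g_n, a_n] vanish, then subtracting
    [g_1, x_{g_1}] = 0 cancels the first term and leaves a sum of n - 1 classes,
    and induction on n gives x = 0. Hence Lambda(A) embeds in a power of A and
    satisfies every identity of A.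

    Since tau(iota(a)) = a, the map iota is injective, and tau identifies the
    restriction of Theta to iota(A) with the induced partial action.

    For uniqueness, let another product have the stated properties. As iota(A)
    is an ideal on which tau inverts iota, and tau is multiplicative,
    iota(a) [k, b] = iota(a pi_k(b)). Translating by g gives
    [g, a] [h, b] = [g, a pi_{g^-1 h}(b)] ([Lambda_mul_unique]). *)

Set Implicit Arguments.
Unset Strict Implicit.
Unset Printing Implicit Defensive.

Local Open Scope classical_set_scope.
Local Open Scope ring_scope.

Import GRing.Theory.

(** * Varieties *)

Section Varieties.
Context {K : comPzRingType}.
Implicit Types A B : naAlg K.

Lemma linear_zero (U V : lmodType K) (f : U -> V) : linear f -> f 0 = 0.
Proof. by move=> lf; have := linearB0 lf (erefl (f 0)); rewrite subr0. Qed.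

Lemma linear_add (U V : lmodType K) (f : U -> V) :
  linear f -> {morph f : x y / x + y}.
Proof. by move=> lf x y; have := lf 1 x y; rewrite !scale1r. Qed.

Lemma linear_sub (U V : lmodType K) (f : U -> V) :
  linear f -> {morph f : x y / x - y}.
Proof.
by move=> lf x y; rewrite -[- y]scaleN1r addrC lf scaleN1r addrC.
Qed.

Lemma linear_comp (U V W : lmodType K) (f : V -> W) (g : U -> V) :
  linear f -> linear g -> linear (f \o g).
Proof. by move=> lf lg k x y; rewrite /= lg lf. Qed.

Lemma hom_eval A B (phi : B -> A) (b : nat -> B) (f : free_alg K) :
  alg_hom phi -> phi (eval b f) = eval (phi \o b) f.
Proof.
case=> lphi phiM.
have le (C : naAlg K) (c : nat -> C) : linear (eval c) := (eval_hom c).1.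
move: f; apply: (free_ext (f := phi \o eval b)) => [||m].
- exact: linear_comp.
- exact: le.
rewrite /= /eval !free_lift_basis.
by elim: m => [j|s IHs t IHt] //=; rewrite phiM IHs IHt.
Qed.

(** An algebra that embeds in a power of A satisfies the identities of A. The
    embedding is given by its coordinates, a jointly injective family. *)
Lemma in_variety_separated (I : set (free_alg K)) A B (T : Type)
    (phi : T -> B -> A) :
  (forall i, alg_hom (phi i)) ->
  (forall z, (forall i, phi i z = 0) -> z = 0) ->
  in_variety I A -> in_variety I B.
Proof.
move=> phi_hom phi_sep AI f If b; apply: phi_sep => i.
by rewrite hom_eval //; exact: AI.
Qed.

End Varieties.

(** * Generation of Lambda by classes *)

Section LambdaClasses.
Context {K : comPzRingType} {G : groupType} {A : naAlg K}.
Variable alpha : paction G A.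

Local Notation L := (Lambda alpha).
Local Notation cl := (Lclass alpha).

Lemma Lambda_ext2 (W : lmodType K) (m m' : L -> L -> W) :
  (forall y, linear (m^~ y)) -> (forall x, linear (m x)) ->
  (forall y, linear (m'^~ y)) -> (forall x, linear (m' x)) ->
  (forall g a h b, m (cl g a) (cl h b) = m' (cl g a) (cl h b)) -> m =2 m'.
Proof.
move=> ml mr ml' mr' e x y; move: x.
apply: (Lambda_ext (f := m^~ y) (f' := m'^~ y)) => // g a.
by move: y; apply: Lambda_ext.
Qed.

(** The classes generate: the projection modulo the submodule that they
    generate vanishes on each class, hence everywhere. *)
Lemma Lambda_span (z : L) :
  exists s : seq (G * A)%type, z = \sum_(p <- s) cl p.1 p.2.
Proof.
pose S : set L := [set x | exists g a, x = cl g a].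
have : submod_gen S z.
  rewrite -[z]subr0; apply/quot_piP; move: z.
  apply: (Lambda_ext (f := quot_pi S) (f' := fun=> quot_pi S 0)) => [||g a].
  - exact: quot_pi_linear.
  - by move=> k x y; rewrite -quot_pi_linear scaler0 addr0.
  by apply/quot_piP; rewrite subr0; apply: sub_submod_gen; exists g, a.
pose N : set L :=
  [set x | exists s : seq (G * A)%type, x = \sum_(p <- s) cl p.1 p.2].
move=> /(_ N); apply; last first.
  by move=> _ [g [a ->]]; exists [:: (g, a)]; rewrite big_seq1.
split; first by exists [::]; rewrite big_nil.
move=> k _ _ [s ->] [t ->]; exists ([seq (p.1, k *: p.2) | p <- s] ++ t).
rewrite big_cat big_map scaler_sumr; congr (_ + _); apply: eq_bigr => p _ /=.
have lcl := Lclass_linear alpha p.1.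
by have := lcl k p.2 0; rewrite (linear_zero lcl) !addr0.
Qed.

Lemma Lambda_theta_comp g h (x : L) :
  Lambda_theta alpha g (Lambda_theta alpha h x) = Lambda_theta alpha (g * h) x.
Proof.
move: x.
apply: (Lambda_ext (f := Lambda_theta alpha g \o Lambda_theta alpha h)).
- by apply: linear_comp; exact: Lambda_theta_linear.
- exact: Lambda_theta_linear.
by move=> k a; rewrite /= !Lambda_thetaE mulgA.
Qed.

Lemma Lambda_theta1 (x : L) : Lambda_theta alpha 1%g x = x.
Proof.
move: x; apply: (Lambda_ext (f' := id)) => [||k a].
- exact: Lambda_theta_linear.
- by [].
by rewrite Lambda_thetaE mul1g.
Qed.

Lemma Lambda_theta_span (z : L) : exists s : seq (G * A)%type,
  z = \sum_(p <- s) Lambda_theta alpha p.1 (Lambda_iota alpha p.2).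
Proof.
have [s ->] := Lambda_span z; exists s; apply: eq_bigr => p _.
by rewrite Lambda_thetaE mulg1.
Qed.

End LambdaClasses.

(** * Global actions *)

(** For a global action, bijectivity of each map comes from the inverse element
    of the group. *)
Lemma total_global_paction (K : comPzRingType) (G : groupType) (B : naAlg K)
    (Theta : G -> B -> B) :
  (forall g, alg_hom (Theta g)) -> (forall x, Theta 1%g x = x) ->
  (forall g h x, Theta g (Theta h x) = Theta (g * h)%g x) ->
  is_paction (total_paction Theta).
Proof.
move=> hom T1 TM; split=> //=; split=> // g.
split=> [|k x y _ _|x y _ _]; [|exact: (hom g).1|exact: (hom g).2].
split=> // [x y _ _ e|x _].
  by rewrite -[x]T1 -(mulVg g) -TM e TM mulVg T1.
by exists (Theta g^-1%g x) => //; rewrite TM mulgV T1.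
Qed.

(** * The algebra Lambda and its components *)

Section LambdaAlgebra.
Context {K : comPzRingType} {G : groupType} {A : naAlg K}.
Variable pi : ideal_prep G A.

Local Notation alpha := (induced pi).
Local Notation L := (Lambda_alg pi).
Local Notation cl := (Lclass alpha).
Local Notation Theta := (Lambda_theta alpha).
Local Notation iota := (Lambda_iota alpha).
Local Notation tau := (Lambda_tau pi).

Lemma Lambda_algM g a h b :
  (cl g a : L) ** (cl h b : L) = cl g (a ** pi (g^-1 * h)%g b).
Proof. exact: Lambda_mulE. Qed.

Lemma prepVK g a : pi g (pi g^-1%g (pi g a)) = pi g a.
Proof. by apply: prepK; exists a. Qed.

Lemma prepM g x y : pi g (x ** y) = pi g x ** pi g y.
Proof. exact: (End0_hom (pi g)).2. Qed.

(** The idempotent endomorphism pi_g pi_{g^-1} is the identity on the ideal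
    im pi_g, which contains both pi_g(a) and its product with x; applying it to
    that product therefore replaces x by pi_g pi_{g^-1} x at no cost. *)
Lemma prep_mul_proj g a x : pi g a ** pi g (pi g^-1%g x) = pi g a ** x.
Proof.
rewrite -{1}[pi g a]prepVK -!prepM prepK //.
by apply: ((prep_ideal pi g).2 _ x _).1; exists a.
Qed.

(** On two classes, the equality to be shown is
    pi_g(a) pi_g(pi_{g^-1 h}(b)) = pi_g(a) pi_h(b). Since
    pi_g pi_{g^-1 h} = pi_g pi_{g^-1} pi_h, it holds by [prep_mul_proj]. *)
Lemma Lambda_tau_hom : alg_hom (tau : L -> A).
Proof.
split; first exact: Lambda_tau_linear.
have [Ll Lr] := na_mul_bilinear L; have [Al Ar] := na_mul_bilinear A.
have lt := @Lambda_tau_linear _ _ _ pi.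
apply: (Lambda_ext2 (alpha := alpha) (m := fun x y : L => tau (x ** y))
                          (m' := fun x y : L => tau x ** tau y)) =>
  [y|x|y|x|g a h b].
- by move=> k u v; rewrite Ll lt.
- by move=> k u v; rewrite Lr lt.
- by move=> k u v; rewrite lt Al.
- by move=> k u v; rewrite lt Ar.
rewrite Lambda_algM !Lambda_tauE prepM.
have := prepVM pi g^-1%g h b; rewrite invgK => <-.
exact: prep_mul_proj.
Qed.

Lemma Lambda_theta_hom g : alg_hom (Theta g : L -> L).
Proof.
have lt := @Lambda_theta_linear _ _ _ alpha g.
split; first exact: lt.
have [Ll Lr] := na_mul_bilinear L.
apply: (Lambda_ext2 (alpha := alpha) (m := fun x y : L => Theta g (x ** y) : L)
          (m' := fun x y : L => (Theta g x : L) ** (Theta g y : L))) =>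
  [y|x|y|x|h a k b].
- by move=> l u v; rewrite Ll lt.
- by move=> l u v; rewrite Lr lt.
- by move=> l u v; rewrite lt Ll.
- by move=> l u v; rewrite lt Lr.
rewrite Lambda_algM !Lambda_thetaE Lambda_algM.
by rewrite invgM -mulgA mulKg.
Qed.

(** The coordinate at g of the standard map from Lambda to functions G -> A,
    sending x to the values of tau on its translates. *)
Definition Lambda_component (g : G) (x : L) : A := tau (Theta g^-1%g x).

Lemma Lambda_component_hom g : alg_hom (Lambda_component g).
Proof.
have [lT TM] := Lambda_theta_hom g^-1%g; have [lt tM] := Lambda_tau_hom.
split; first exact: linear_comp.
by move=> x y; rewrite /Lambda_component TM tM.
Qed.

Lemma Lambda_componentE g h a : Lambda_component g (cl h a) = pi (g^-1 * h)%g a.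
Proof. by rewrite /Lambda_component Lambda_thetaE Lambda_tauE. Qed.

(** Taking the part at g of a class at h yields a class that again lives at h:
    the component belongs to im pi_{g^-1 h}, so the defining relations of
    Lambda carry it from g back to h. *)
Lemma Lclass_component g h a :
  cl g (Lambda_component g (cl h a))
  = cl h (pi (h^-1 * g)%g (Lambda_component g (cl h a))).
Proof.
rewrite Lambda_componentE; set k := (h^-1 * g)%g.
have -> : (g^-1 * h = k^-1)%g by rewrite invgM invgK.
rewrite -[in LHS](prepVK k^-1%g) invgK.
rewrite (Lclass_act (alpha := alpha)) /=.
  by rewrite invgM invgK mulVKg.
by exists (pi k^-1%g a); rewrite ?invgK.
Qed.

(** An element with zero components equals x - [g, x_g] for each g, where x_g is
    its component at g. If g is the index of the first class in a sum
    representing x, this removes that class, and by [Lclass_component] the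
    other classes keep their indices: x is a sum of fewer classes. *)
Lemma Lambda_component_sep (x : L) :
  (forall g, Lambda_component g x = 0) -> x = 0.
Proof.
have [s ->] := Lambda_span x.
have lc g : linear (Lambda_component g) := (Lambda_component_hom g).1.
have lcl g : linear (cl g) := Lclass_linear alpha g.
have [n] := ubnP (size s); elim: n s => // n IHn [|[g a] s] /=.
  by rewrite big_nil.
rewrite ltnS big_cons /= => sz c0; set z := _ + _ in c0 *.
pose drop (p : G * A) :=
  (p.1, p.2 - pi (p.1^-1 * g)%g (Lambda_component g (cl p.1 p.2))).
have zE : z = \sum_(p <- map drop s) cl p.1 p.2.
  have -> : z = z - cl g (Lambda_component g z).
    by rewrite c0 (linear_zero (lcl g)) subr0.
  rewrite {2}/z (linear_add (lc g)) (linear_add (lcl g)).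
  rewrite Lambda_componentE mulVg prep1.
  (* The term at g is its own part at g, so it cancels. *)
  rewrite /z opprD addrACA subrr add0r big_map.
  elim: (s) => [|[h b] t IHt].
    by rewrite !big_nil (linear_zero (lc g)) (linear_zero (lcl g)) subrr.
  rewrite !big_cons /= (linear_add (lc g)) (linear_add (lcl g)) opprD addrACA.
  by rewrite IHt (linear_sub (lcl h)) Lclass_component.
rewrite zE; apply: IHn; first by rewrite size_map.
by rewrite -zE.
Qed.

Lemma Lambda_tau_iota a : tau (iota a) = a.
Proof. by rewrite Lambda_tauE prep1. Qed.

Lemma Lambda_in_variety (I : set (free_alg K)) :
  in_variety I A -> in_variety I L.
Proof.
exact: in_variety_separated Lambda_component_hom Lambda_component_sep.
Qed.

(** * The globalization on Lambda *)

Lemma Lambda_iota_hom : alg_hom (iota : A -> L).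
Proof.
split; first exact: Lclass_linear.
by move=> x y; rewrite Lambda_algM invg1 mulg1 prep1.
Qed.

(** The multiples of iota(a) are computed by tau: iota(a) y = iota(a tau(y)) is
    immediate on classes. For y iota(a) with y = [h, b], the product is
    [h, b pi_{h^-1}(a)], whose second entry lies in im pi_{h^-1} and can
    therefore be moved to the index 1, giving iota(tau(y) a). *)
Lemma Lambda_iota_ideal : is_ideal (range (iota : A -> L)).
Proof.
have li : linear iota := Lclass_linear alpha 1%g.
have [Ll Lr] := na_mul_bilinear L.
split.
  split; first by exists 0 => //; exact: linear_zero.
  by move=> k _ _ [a _ <-] [b _ <-]; exists (k *: a + b) => //; rewrite li.
move=> _ y [a _ <-]; split.
  exists (a ** tau y) => //; move: y.
  apply: (Lambda_ext (alpha := alpha) (f := fun y => iota (a ** tau y))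
            (f' := fun y : L => (iota a : L) ** y)) => [k u v|k u v|h b].
  - by rewrite Lambda_tau_linear (na_mul_bilinear A).2 li.
  - by rewrite Lr.
  by rewrite Lambda_algM Lambda_tauE invg1 mul1g.
exists (tau y ** a) => //; move: y.
apply: (Lambda_ext (alpha := alpha) (f := fun y => iota (tau y ** a))
          (f' := fun y : L => y ** (iota a : L))) => [k u v|k u v|h b].
- by rewrite Lambda_tau_linear (na_mul_bilinear A).1 li.
- by rewrite Ll.
rewrite Lambda_algM Lambda_tauE mulg1.
have := @Lclass_act _ _ _ alpha 1%g h (b ** pi h^-1%g a); rewrite mul1g => <-.
  by rewrite /= prepM prep_mul_proj.
by apply: ((prep_ideal pi h^-1%g).2 _ b _).2; exists a.
Qed.

Lemma Lambda_iota_prep g a :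
  range (pi g^-1%g) a -> iota (pi g a) = Theta g (iota a).
Proof.
by move=> ga; rewrite Lambda_thetaE /Lambda_iota mulg1 -{2}[g]mul1g -Lclass_act.
Qed.

Lemma Lambda_iota_equivariant :
  equivariant alpha (total_paction (Theta : G -> L -> L)) (iota : A -> L).
Proof.
by split=> //; [exact: Lambda_iota_hom|exact: Lambda_iota_prep].
Qed.

(** The isomorphism is iota, with inverse tau restricted to iota(A). For the
    domains: iota(a) is also in Theta_g(iota(A)) exactly when a is in im pi_g,
    because iota(a) = [g, c] gives a = pi_g(c) after applying tau. *)
Lemma Lambda_restriction (hC : is_ideal (range (iota : A -> L))) :
  isomorphic alpha (restriction (total_paction (Theta : G -> L -> L)) hC).
Proof.
have mem_iota a : (iota a : L) \in range (iota : A -> L).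
  by rewrite inE; exists a.
pose phi a : ideal_alg hC := Sub (iota a : L) (mem_iota a) : ideal_sort hC.
pose psi (x : ideal_alg hC) : A := tau (val (x : ideal_sort hC)).
have phiE (x : ideal_sort hC) a : val x = iota a -> x = phi a.
  by move=> e; apply: val_inj.
have phi_surj (x : ideal_sort hC) : exists a, x = phi a.
  by have := valP x; rewrite inE => -[a _ /esym/phiE ->]; exists a.
have phiK : cancel phi psi by move=> a; exact: Lambda_tau_iota.
have psiK : cancel psi phi by move=> x; have [a ->] := phi_surj x; rewrite phiK.
have [li iM] := Lambda_iota_hom; have [lt tM] := Lambda_tau_hom.
have phi_hom : alg_hom phi.
  by split=> [k x y|x y]; apply: val_inj; [exact: li|exact: iM].
have dom_phi g a : dom alpha g a ->
    dom (restriction (total_paction (Theta : G -> L -> L)) hC) g (phi a).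
  move=> /= ga; split; first by exists a.
  exists (iota (pi g^-1%g a)); first by exists (pi g^-1%g a).
  by rewrite -Lambda_iota_prep ?prepK //.
have act_phi g a : dom alpha g^-1%g a ->
    phi (act alpha g a)
    = act (restriction (total_paction (Theta : G -> L -> L)) hC) g (phi a).
  move=> ga; apply: val_inj => /=; rewrite -(Lambda_iota_prep ga).
  have := val_insubd (phi a : ideal_sort hC) (iota (pi g a) : L).
  by rewrite mem_iota.
have dom_psi g a :
    dom (restriction (total_paction (Theta : G -> L -> L)) hC) g (phi a) ->
    dom alpha g a.
  move=> /= [_ [_ [c _ <-] /(congr1 tau)]].
  by rewrite /= Lambda_tau_iota Lambda_thetaE mulg1 Lambda_tauE => <-; exists c.
exists phi, psi; split=> //; split=> //.
- by move=> g _ [a ga <-]; exact: dom_phi.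
- by split=> [k x y|x y]; [exact: lt|exact: tM].
- move=> g y [x]; have [a ->] := phi_surj x => ga <-.
  by rewrite phiK; exact: dom_psi.
move=> g x; have [a ->] := phi_surj x => /dom_psi ga.
by rewrite -act_phi // !phiK.
Qed.

Lemma Lambda_globalization (I : set (free_alg K)) : in_variety I A ->
  is_globalization I alpha (total_paction (Theta : G -> L -> L))
    (iota : A -> L).
Proof.
move=> AI; split.
- by split=> //; exact: induced_paction.
- split=> //; first exact: Lambda_in_variety.
  apply: total_global_paction; first exact: Lambda_theta_hom.
    exact: Lambda_theta1.
  exact: Lambda_theta_comp.
- by split; [exact: can_inj Lambda_tau_iota|exact: Lambda_iota_equivariant].
- by exists Lambda_iota_ideal; exact: Lambda_restriction.
exact: Lambda_theta_span.
Qed.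

(** A product iota(a) z lies in iota(A), on which tau is injective, so
    multiplicativity of tau forces iota(a) z = iota(a tau(z)). Translation
    by g then determines [g, a] [h, b], and classes generate. *)
Lemma Lambda_mul_unique (mul : L -> L -> L) (mulB : bilinear_op mul) :
  let B := NaAlg mulB in
  alg_hom (tau : B -> A) ->
  (forall a y, range iota (mul (iota a) y)) ->
  (forall g, {morph (Theta g : L -> L) : x y / mul x y}) ->
  Lambda_mul pi = mul.
Proof.
move=> B tau_hom iota_ideal thetaM; apply/funext => x; apply/funext => y.
have [Ll Lr] := na_mul_bilinear L; have [Bl Br] := mulB.
have iota_mul a z : mul (iota a) z = iota (a ** tau z).
  have tauM : tau (mul (iota a) z) = tau (iota a) ** tau z := tau_hom.2 _ z.
  have [c _ e] := iota_ideal a z.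
  by rewrite -e !Lambda_tau_iota in tauM *; rewrite tauM.
apply: (Lambda_ext2 (alpha := alpha)) => // g a h b.
have -> : cl g a = Theta g (iota a) by rewrite Lambda_thetaE mulg1.
have -> : cl h b = Theta g (cl (g^-1 * h)%g b) by rewrite Lambda_thetaE mulVKg.
rewrite -thetaM iota_mul Lambda_tauE !Lambda_thetaE mulg1 mulVKg.
by rewrite Lambda_mulE.
Qed.

End LambdaAlgebra.

Theorem theorem2p6 (K : comPzRingType) (G : groupType)
    (I : set (free_alg K)) (A : naAlg K) (pi : ideal_prep G A)
    (AI : in_variety I A)
    (hI : forall f, I f ->
       exists i : nat, forall m : monomial, m \in supp f -> occurs i m) :
  let alpha := induced pi in
  let L := Lambda alpha in
  let iota : A -> L := Lambda_iota alpha in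
  let Theta : G -> L -> L := Lambda_theta alpha in
  let tau : L -> A := Lambda_tau pi in
  let P (mul : L -> L -> L) : Prop :=
    exists mulB : bilinear_op mul,
      let B : naAlg K := NaAlg mulB in
      [/\ alg_hom (tau : B -> A),
          is_ideal (range (iota : A -> B))
        & is_globalization I alpha (total_paction (Theta : G -> B -> B))
            (iota : A -> B)] in
  [/\ in_variety I (Lambda_alg pi),
      is_globalization I alpha
        (total_paction (Theta : G -> Lambda_alg pi -> Lambda_alg pi))
        (iota : A -> Lambda_alg pi)
    & unique P (Lambda_mul pi)].
Proof.
move=> alpha L iota Theta tau P.
have gl : is_globalization I alpha
    (total_paction (Theta : G -> Lambda_alg pi -> Lambda_alg pi))
    (iota : A -> Lambda_alg pi) by exact: Lambda_globalization.
split=> //; first exact: Lambda_in_variety.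
split.
  exists (Lambda_mul_bilinear pi); split=> //; first exact: Lambda_tau_hom.
  exact: Lambda_iota_ideal.
(* That Theta acts by automorphisms of the new product comes from the
   globalization: it is the component iso of Theta being a partial action. *)
move=> mul [mulB [tau_hom [_ iotaC] [_ [_ [[_ iso] _ _ _] _] _ _ _]]].
apply: (Lambda_mul_unique tau_hom) => [a y|g x y].
  by apply: (iotaC (iota a) y _).1; exists a.
have [_ _ thM] := iso g.
by apply: thM.
Qed.
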